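(* Let $F$ be a field and let $\mathbf{n}$ be a supernatural number. Suppose $\mathbf{n}=\prod_{t\geq 1} m_t$ where $m_t\in\mathbb{N}$ and $m_1>1$. An $F$-algebra contains $\operatorname{M}_{\mathbf{n}}(F)$ if and only if it has elements $a$, $c$ and $b_1,b_2,\dots$ such that, with $b_0=0$, $$b_t^{m_t}=b_{t-1}\quad\text{for all } t\ge 1,$$ $$a b_1+b_1^{m_1-1}c=1.$$
   Context: Algebras are unital, associative and nonzero, and ''contains'' means containing a unital subalgebra (with the same identity element) isomorphic to the given algebra. A supernatural number is a formal product $\prod_p p^{\alpha_p}$ over the primes, with $\alpha_p\in\mathbb{N}\cup\{\infty\}$ ($0$ allowed). The supernatural matrix algebra $\operatorname{M}_{\mathbf{n}}(F)$ is the direct limit of the matrix algebras $\operatorname{M}_n(F)$ over the natural divisors $n$ of $\mathbf{n}$, with the maps $\operatorname{M}_m(F)\to\operatorname{M}_n(F)$, $x\mapsto x\otimes 1=\operatorname{diag}(x,\dots,x)$, whenever $m\mid n$. *)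

(* Defs.v *)
From HB Require Import structures.
From mathcomp Require Import all_boot all_order all_algebra generic_quotient.

Set Implicit Arguments.
Unset Strict Implicit.
Unset Printing Implicit Defensive.

Import GRing.Theory.
Local Open Scope ring_scope.
Local Open Scope quotient_scope.

(* The exponent of each prime; [None] is the exponent oo.  The second field
   makes the values at non-primes irrelevant. *)
Record supernatural := Supernatural {
  sn_exp :> nat -> option nat;
  sn_exp_nprime : forall p, ~~ prime p -> sn_exp p = Some 0%N
}.

Definition exp_le (k : nat) (e : option nat) : bool :=
  if e is Some a then (k <= a)%N else true.

(* Only the prime factors of [d] need to be tested, which keeps the predicate
   boolean; [dvd_snP] gives the version quantified over all primes. *)
Definition dvd_sn (d : nat) (n : supernatural) : bool :=
  (0 < d)%N && all (fun p => exp_le (logn p d) (n p)) (primes d).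

Lemma dvd_snP d (n : supernatural) :
  reflect ((0 < d)%N /\ forall p, prime p -> exp_le (logn p d) (n p))
          (dvd_sn d n).
Proof.
apply: (iffP andP) => -[d0 H]; split=> //.
  move=> p pp; have [pd|] := boolP (p \in primes d); first exact: (allP H).
  by rewrite -logn_gt0 -eqn0Ngt => /eqP->; case: (n p).
by apply/allP=> p; rewrite mem_primes => /andP[pp _]; apply: H.
Qed.

(* [n] = \prod_(t >= 1) m_t : at each prime, the exponent in [n] is the (finite
   or infinite) value of the series \sum_(t >= 1) v_p(m_t). *)
Definition is_sn_prod (n : supernatural) (m : nat -> nat) : Prop :=
  forall p, prime p ->
    match n p with
    | Some k => exists T0, forall T, (T0 <= T)%N ->
                  (\sum_(1 <= t < T) logn p (m t))%N = k
    | None => forall k, exists T, (k <= \sum_(1 <= t < T) logn p (m t))%N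
    end.

Record divisor (n : supernatural) := Divisor {
  div_val :> nat;
  div_valP : dvd_sn div_val n
}.

HB.instance Definition _ n := [isSub for @div_val n].
HB.instance Definition _ n := [Choice of divisor n by <:].

Lemma div_gt0 n (d : divisor n) : (0 < d)%N.
Proof. by case: d => d /= /andP[]. Qed.

Lemma dvd_sn1 n : dvd_sn 1 n.
Proof. by []. Qed.

Definition div1 n : divisor n := Divisor (dvd_sn1 n).

Lemma dvd_sn_lcm n (d e : divisor n) : dvd_sn (lcmn d e) n.
Proof.
have /dvd_snP[d0 Hd] := div_valP d; have /dvd_snP[e0 He] := div_valP e.
apply/dvd_snP; split=> [|p pp]; first by rewrite lcmn_gt0 d0.
by rewrite logn_lcm // /maxn; case: ifP => _; auto.
Qed.

Definition div_lcm n (d e : divisor n) : divisor n := Divisor (dvd_sn_lcm d e).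

Section DiagRep.
Variable F : fieldType.

(* For d | k this is x |-> x (x) 1 = diag(x, ..., x) from M_d(F) to M_k(F):
   the entry at (q d + r, q' d + r') is x_(r, r') if q = q', and 0 otherwise. *)
Definition diag_rep (d : nat) (d_gt0 : (0 < d)%N) (k : nat) (x : 'M[F]_d) :
    'M[F]_k :=
  \matrix_(i < k, j < k)
    if (i %/ d == j %/ d)%N then
      x (Ordinal (ltn_pmod i d_gt0)) (Ordinal (ltn_pmod j d_gt0))
    else 0.

Section Fixed.
Variables (d k : nat) (d_gt0 : (0 < d)%N).

Lemma diag_repD : {morph diag_rep d_gt0 k : x y / x + y}.
Proof.
by move=> x y; apply/matrixP=> i j; rewrite !mxE; case: ifP => // _; rewrite addr0.
Qed.

Lemma diag_repZ a : {morph diag_rep d_gt0 k : x / a *: x}.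
Proof.
by move=> x; apply/matrixP=> i j; rewrite !mxE; case: ifP => // _; rewrite mulr0.
Qed.

Lemma diag_repN : {morph diag_rep d_gt0 k : x / - x}.
Proof. by move=> x; rewrite -scaleN1r diag_repZ scaleN1r. Qed.

Lemma diag_rep0 : diag_rep d_gt0 k 0 = 0.
Proof. by rewrite -(scale0r (0 : 'M_d)) diag_repZ scale0r. Qed.

Lemma diag_rep1 : diag_rep d_gt0 k 1%:M = 1%:M.
Proof.
apply/matrixP=> i j; rewrite !mxE -!val_eqE /=.
have [->|ne] := eqVneq (i : nat) j; first by rewrite !eqxx.
case: ifP => // /eqP q; case: eqP => // r.
by move: ne; rewrite (divn_eq i d) q r -divn_eq eqxx.
Qed.

Lemma diag_repM : (d %| k)%N ->
  {morph diag_rep d_gt0 k : x y / x *m y}.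
Proof.
move=> dk x y; apply/matrixP=> i j; rewrite !mxE.
have hlt (r : 'I_d) : (i %/ d * d + r < k)%N.
  apply: (@leq_trans ((i %/ d).+1 * d)); first by rewrite mulSn addnC ltn_add2r.
  by rewrite -[leqRHS](divnK dk) leq_mul2r ltn_divRL // (leq_ltn_trans (leq_divM _ _)) ?orbT.
have hq (r : 'I_d) : ((i %/ d * d + r) %/ d = i %/ d)%N.
  by rewrite divnMDl // (divn_small (ltn_ord r)) addn0.
have hr (r : 'I_d) : ((i %/ d * d + r) %% d = r)%N.
  by rewrite modnMDl modn_small // ltn_ord.
pose h (r : 'I_d) : 'I_k := Ordinal (hlt r).
rewrite (bigID (fun l : 'I_k => i %/ d == l %/ d)%N) /= [X in _ + X]big1 ?addr0; last first.
  by move=> l /negbTE nl; rewrite !mxE nl mul0r.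
rewrite (reindex_onto h (fun l => Ordinal (ltn_pmod l d_gt0))) /=; last first.
  by move=> l /eqP q; apply: val_inj; rewrite /= q -divn_eq.
transitivity (\sum_(r < d)
   (x (Ordinal (ltn_pmod i d_gt0)) r *
    (if (i %/ d == j %/ d)%N then y r (Ordinal (ltn_pmod j d_gt0)) else 0))).
  by case: ifP => _ //; rewrite big1 // => r _; rewrite mulr0.
apply: eq_big => r; last first.
  have er : Ordinal (ltn_pmod (h r) d_gt0) = r by apply: val_inj; rewrite /= hr.
  by move=> _; rewrite !mxE /= hq eqxx er.
by rewrite hq eqxx /=; apply/esym/eqP/val_inj; rewrite /= hr.
Qed.

Lemma diag_rep_inj : (d %| k)%N -> (0 < k)%N -> injective (diag_rep d_gt0 k).
Proof.
move=> dk k0 x y exy; apply/matrixP=> i j.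
have w (r : 'I_d) : (r < k)%N by apply: leq_trans (ltn_ord r) (dvdn_leq k0 dk).
have /matrixP/(_ (Ordinal (w i)) (Ordinal (w j))) := exy.
have er (r : 'I_d) : Ordinal (ltn_pmod r d_gt0) = r.
  by apply: val_inj; rewrite /= modn_small.
by rewrite !mxE /= !divn_small // eqxx !er.
Qed.

End Fixed.

Lemma diag_rep_comp d e k (d_gt0 : (0 < d)%N) (e_gt0 : (0 < e)%N) x :
  (d %| e)%N ->
  diag_rep e_gt0 k (diag_rep d_gt0 e x) = diag_rep d_gt0 k x.
Proof.
move=> de; apply/matrixP=> i j; rewrite !mxE /=.
have qE (a : nat) : (a %/ d = a %/ e * (e %/ d) + (a %% e) %/ d)%N.
  by rewrite {1}(divn_eq a e) -{2}(divnK de) mulnA divnMDl.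
have rlt (a : nat) : ((a %% e) %/ d < e %/ d)%N.
  by rewrite ltn_divRL // (leq_ltn_trans (leq_divM _ _)) // ltn_pmod.
have rE (a : nat) : Ordinal (ltn_pmod (a %% e) d_gt0) = Ordinal (ltn_pmod a d_gt0).
  by apply: val_inj; rewrite /= modn_dvdm.
rewrite !rE; have [qe|ne] := eqVneq (i %/ e)%N (j %/ e)%N.
  by rewrite [in RHS](qE i) [in RHS](qE j) qe eqn_add2l.
case: eqP => // ij; case/eqP: ne.
have ed0 : (0 < e %/ d)%N by rewrite divn_gt0 // dvdn_leq.
have := congr1 (fun z => z %/ (e %/ d))%N ij.
by rewrite /= (qE i) (qE j) !divnMDl // !(divn_small (rlt _)) !addn0.
Qed.

End DiagRep.

Section SupernaturalMatrix.
Variables (F : fieldType) (n : supernatural).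

Definition diag_map (d e : divisor n) : 'M[F]_d -> 'M[F]_e :=
  diag_rep (div_gt0 d) e.

Definition smx_pre := {d : divisor n & 'M[F]_d}.

Definition smx_tag (d : divisor n) (x : 'M[F]_d) : smx_pre :=
  Tagged (fun d : divisor n => 'M[F]_d) x.

(* [x] in M_d(F) and [y] in M_e(F) are identified when they have the same image
   in M_k(F), where k = lcm(d, e).  By [smx_equivP], as the transition maps are
   injective, any common multiple k may be used instead. *)
Definition smx_equiv (u v : smx_pre) : bool :=
  diag_map (div_lcm (tag u) (tag v)) (tagged u) ==
  diag_map (div_lcm (tag u) (tag v)) (tagged v).

Lemma smx_equivP (d e k : divisor n) (x : 'M[F]_d) (y : 'M[F]_e) :
  (d %| k)%N -> (e %| k)%N ->
  smx_equiv (smx_tag x) (smx_tag y) = (diag_map k x == diag_map k y).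
Proof.
move=> dk ek; rewrite /smx_equiv /=.
have lk : (div_lcm d e %| k)%N by rewrite dvdn_lcm dk.
rewrite -(inj_eq (diag_rep_inj (d_gt0 := div_gt0 (div_lcm d e)) lk (div_gt0 k))).
by rewrite !diag_rep_comp ?dvdn_lcml ?dvdn_lcmr.
Qed.

Lemma smx_equiv_refl : reflexive smx_equiv.
Proof. by move=> u; rewrite /smx_equiv. Qed.

Lemma smx_equiv_sym : symmetric smx_equiv.
Proof.
move=> [d x] [e y]; rewrite -![existT _ _ _]/(smx_tag _).
by rewrite !(@smx_equivP _ _ (div_lcm d e)) ?dvdn_lcml ?dvdn_lcmr // eq_sym.
Qed.

Lemma smx_equiv_trans : transitive smx_equiv.
Proof.
move=> [e y] [d x] [f z]; rewrite -![existT _ _ _]/(smx_tag _).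
pose k := div_lcm (div_lcm d e) f.
have dk : (d %| k)%N by rewrite (dvdn_trans (dvdn_lcml d e)) ?dvdn_lcml.
have ek : (e %| k)%N by rewrite (dvdn_trans (dvdn_lcmr d e)) ?dvdn_lcml.
have fk : (f %| k)%N by rewrite dvdn_lcmr.
by rewrite !(@smx_equivP _ _ k) // => /eqP-> /eqP->.
Qed.

Canonical smx_equiv_rel :=
  EquivRel smx_equiv smx_equiv_refl smx_equiv_sym smx_equiv_trans.

(* The direct limit of the M_d(F), d | n, along the maps [diag_map]. *)
Definition smx := {eq_quot smx_equiv}.

HB.instance Definition _ : EqQuotient _ smx_equiv smx := EqQuotient.on smx.
HB.instance Definition _ := Choice.on smx.

Definition smx_in (d : divisor n) (x : 'M[F]_d) : smx := \pi_smx (smx_tag x).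

Lemma smx_inE (d e k : divisor n) (x : 'M[F]_d) (y : 'M[F]_e) :
  (d %| k)%N -> (e %| k)%N ->
  (smx_in x = smx_in y) <-> (diag_map k x = diag_map k y).
Proof.
move=> dk ek; split=> [/eqmodP|] /=; first by rewrite (smx_equivP _ _ dk ek) => /eqP.
by move=> h; apply/eqmodP; rewrite /= (smx_equivP _ _ dk ek) h.
Qed.

Lemma smx_in_inj (d : divisor n) : injective (@smx_in d).
Proof.
by move=> x y /(smx_inE x y (dvdnn d) (dvdnn d)); apply: (diag_rep_inj (dvdnn d) (div_gt0 d)).
Qed.

Lemma smx_in_compat (d e : divisor n) (x : 'M[F]_d) :
  (d %| e)%N -> smx_in (diag_map e x) = smx_in x.
Proof.
move=> de; apply/(smx_inE _ _ (dvdnn e) de).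
exact: diag_rep_comp.
Qed.

Lemma smx_in_surj (u : smx) : exists (d : divisor n) (x : 'M[F]_d), u = smx_in x.
Proof. by elim/quotW: u => -[d x]; exists d, x. Qed.

Lemma smx_in_surj2 (u v : smx) :
  exists (d : divisor n) (x y : 'M[F]_d), u = smx_in x /\ v = smx_in y.
Proof.
have [d [x ->]] := smx_in_surj u; have [e [y ->]] := smx_in_surj v.
exists (div_lcm d e), (diag_map _ x), (diag_map _ y).
by rewrite !smx_in_compat ?dvdn_lcml ?dvdn_lcmr.
Qed.

Lemma smx_in_surj3 (u v w : smx) :
  exists (d : divisor n) (x y z : 'M[F]_d),
    [/\ u = smx_in x, v = smx_in y & w = smx_in z].
Proof.
have [d [x [y [-> ->]]]] := smx_in_surj2 u v; have [e [z ->]] := smx_in_surj w.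
exists (div_lcm d e), (diag_map _ x), (diag_map _ y), (diag_map _ z).
by rewrite !smx_in_compat ?dvdn_lcml ?dvdn_lcmr.
Qed.

Definition smx_lift1 (op : forall d : divisor n, 'M[F]_d -> 'M[F]_d)
    (u : smx) : smx :=
  smx_in (op _ (tagged (repr u))).

Definition smx_lift2
    (op : forall d : divisor n, 'M[F]_d -> 'M[F]_d -> 'M[F]_d)
    (u v : smx) : smx :=
  let d := div_lcm (tag (repr u)) (tag (repr v)) in
  smx_in (op d (diag_map d (tagged (repr u))) (diag_map d (tagged (repr v)))).

Definition smx_zero : smx := smx_in (0 : 'M[F]_(div1 n)).
Definition smx_one : smx := smx_in (1%:M : 'M[F]_(div1 n)).
Definition smx_opp := smx_lift1 (fun d x => - x).
Definition smx_scale (a : F) := smx_lift1 (fun d x => a *: x).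
Definition smx_add := smx_lift2 (fun d x y => x + y).
Definition smx_mul := smx_lift2 (fun d x y => x *m y).

Lemma smx_reprE (u : smx) : smx_in (tagged (repr u)) = u.
Proof. by rewrite -[RHS]reprK /smx_in; case: (repr u). Qed.

Lemma smx_lift1E op (d : divisor n) (x : 'M[F]_d) :
  (forall (e k : divisor n) (z : 'M_e), (e %| k)%N ->
     diag_map k (op e z) = op k (diag_map k z)) ->
  smx_lift1 op (smx_in x) = smx_in (op d x).
Proof.
move=> opE; rewrite /smx_lift1; set u := smx_in x.
have := smx_reprE u; rewrite {2}/u; move: (tag _) (tagged _) => e y exy.
have [ek dk] := (dvdn_lcml e d, dvdn_lcmr e d).
apply/(smx_inE (k := div_lcm e d) _ _ ek dk); rewrite !opE //.
by congr op; apply/smx_inE.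
Qed.

Lemma smx_lift2E op (d : divisor n) (x y : 'M[F]_d) :
  (forall (e k : divisor n) (z w : 'M_e), (e %| k)%N ->
     diag_map k (op e z w) = op k (diag_map k z) (diag_map k w)) ->
  smx_lift2 op (smx_in x) (smx_in y) = smx_in (op d x y).
Proof.
move=> opE; rewrite /smx_lift2; set u := smx_in x; set v := smx_in y.
have := smx_reprE u; have := smx_reprE v; rewrite {2}/u {2}/v.
move: (tag (repr u)) (tagged (repr u)) (tag (repr v)) (tagged (repr v)) => e x' f y' ey ex.
set g := div_lcm e f.
have [gk dk] := (dvdn_lcml g d, dvdn_lcmr g d).
have [eg fg] : (e %| g)%N /\ (f %| g)%N by rewrite dvdn_lcml dvdn_lcmr.
have [ek fk] := (dvdn_trans eg gk, dvdn_trans fg gk).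
apply/(smx_inE (k := div_lcm g d) _ _ gk dk); rewrite !opE //.
rewrite /diag_map !diag_rep_comp // -/(diag_map _ _).
by congr op; apply/smx_inE.
Qed.

Lemma smx_in0 (d : divisor n) : smx_in (0 : 'M[F]_d) = smx_zero.
Proof. by apply/(smx_inE (e := div1 n) _ _ (dvdnn d) (dvd1n d)); rewrite /diag_map !diag_rep0. Qed.

Lemma smx_in1 (d : divisor n) : smx_in (1%:M : 'M[F]_d) = smx_one.
Proof. by apply/(smx_inE (e := div1 n) _ _ (dvdnn d) (dvd1n d)); rewrite /diag_map !diag_rep1. Qed.

Lemma smx_inN (d : divisor n) (x : 'M[F]_d) : smx_in (- x) = smx_opp (smx_in x).
Proof. by rewrite /smx_opp smx_lift1E // => e k z _; apply: diag_repN. Qed.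

Lemma smx_inZ (d : divisor n) a (x : 'M[F]_d) :
  smx_in (a *: x) = smx_scale a (smx_in x).
Proof. by rewrite /smx_scale smx_lift1E // => e k z _; apply: diag_repZ. Qed.

Lemma smx_inD (d : divisor n) (x y : 'M[F]_d) :
  smx_in (x + y) = smx_add (smx_in x) (smx_in y).
Proof. by rewrite /smx_add smx_lift2E // => e k z w _; apply: diag_repD. Qed.

Lemma smx_inM (d : divisor n) (x y : 'M[F]_d) :
  smx_in (x *m y) = smx_mul (smx_in x) (smx_in y).
Proof. by rewrite /smx_mul smx_lift2E // => e k z w ek; apply: diag_repM. Qed.

Fact smx_addA : associative smx_add.
Proof.
move=> u v w; have [d [x [y [z [-> -> ->]]]]] := smx_in_surj3 u v w.
by rewrite -!smx_inD addrA.
Qed.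

Fact smx_addC : commutative smx_add.
Proof.
move=> u v; have [d [x [y [-> ->]]]] := smx_in_surj2 u v.
by rewrite -!smx_inD addrC.
Qed.

Fact smx_add0 : left_id smx_zero smx_add.
Proof.
by move=> u; have [d [x ->]] := smx_in_surj u; rewrite -(smx_in0 d) -smx_inD add0r.
Qed.

Fact smx_addN : left_inverse smx_zero smx_opp smx_add.
Proof.
move=> u; have [d [x ->]] := smx_in_surj u.
by rewrite -smx_inN -smx_inD addNr smx_in0.
Qed.

HB.instance Definition _ :=
  GRing.isZmodule.Build smx smx_addA smx_addC smx_add0 smx_addN.

Fact smx_mulA : associative smx_mul.
Proof.
move=> u v w; have [d [x [y [z [-> -> ->]]]]] := smx_in_surj3 u v w.
by rewrite -!smx_inM mulmxA.
Qed.

Fact smx_mul1 : left_id smx_one smx_mul.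
Proof.
by move=> u; have [d [x ->]] := smx_in_surj u; rewrite -(smx_in1 d) -smx_inM mul1mx.
Qed.

Fact smx_1mul : right_id smx_one smx_mul.
Proof.
by move=> u; have [d [x ->]] := smx_in_surj u; rewrite -(smx_in1 d) -smx_inM mulmx1.
Qed.

Fact smx_mulDl : left_distributive smx_mul +%R.
Proof.
move=> u v w; have [d [x [y [z [-> -> ->]]]]] := smx_in_surj3 u v w.
by rewrite -![_ + _]/(smx_add _ _) -!(smx_inD, smx_inM) mulmxDl.
Qed.

Fact smx_mulDr : right_distributive smx_mul +%R.
Proof.
move=> u v w; have [d [x [y [z [-> -> ->]]]]] := smx_in_surj3 u v w.
by rewrite -![_ + _]/(smx_add _ _) -!(smx_inD, smx_inM) mulmxDr.
Qed.

Fact smx_one_neq0 : smx_one != 0.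
Proof.
apply/eqP=> /smx_in_inj /matrixP/(_ ord0 ord0) /eqP.
by rewrite !mxE eqxx oner_eq0.
Qed.

HB.instance Definition _ := GRing.Zmodule_isNzRing.Build smx
  smx_mulA smx_mul1 smx_1mul smx_mulDl smx_mulDr smx_one_neq0.

Fact smx_scaleA a b u : smx_scale a (smx_scale b u) = smx_scale (a * b) u.
Proof. by have [d [x ->]] := smx_in_surj u; rewrite -!smx_inZ scalerA. Qed.

Fact smx_scale1 : left_id 1 smx_scale.
Proof. by move=> u; have [d [x ->]] := smx_in_surj u; rewrite -smx_inZ scale1r. Qed.

Fact smx_scaleDr : right_distributive smx_scale +%R.
Proof.
move=> a u v; have [d [x [y [-> ->]]]] := smx_in_surj2 u v.
by rewrite -![_ + _]/(smx_add _ _) -!(smx_inZ, smx_inD) scalerDr.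
Qed.

Fact smx_scaleDl u : {morph smx_scale^~ u : a b / a + b}.
Proof.
move=> a b; have [d [x ->]] := smx_in_surj u.
by rewrite -[RHS]/(smx_add _ _) -!(smx_inZ, smx_inD) scalerDl.
Qed.

HB.instance Definition _ := GRing.Zmodule_isLmodule.Build F smx
  smx_scaleA smx_scale1 smx_scaleDr smx_scaleDl.

Fact smx_scaleAl (a : F) (u v : smx) : a *: (u * v) = (a *: u) * v.
Proof.
have [d [x [y [-> ->]]]] := smx_in_surj2 u v.
rewrite -[_ * _]/(smx_mul _ _) -[RHS]/(smx_mul (smx_scale _ _) _).
by rewrite -[LHS]/(smx_scale _ _) -!(smx_inM, smx_inZ) scalemxAl.
Qed.

HB.instance Definition _ := GRing.Lmodule_isLalgebra.Build F smx smx_scaleAl.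

Fact smx_scaleAr (a : F) (u v : smx) : a *: (u * v) = u * (a *: v).
Proof.
have [d [x [y [-> ->]]]] := smx_in_surj2 u v.
rewrite -[_ * _]/(smx_mul _ _) -[RHS]/(smx_mul _ (smx_scale _ _)).
by rewrite -[LHS]/(smx_scale _ _) -!(smx_inM, smx_inZ) scalemxAr.
Qed.

HB.instance Definition _ := GRing.Lalgebra_isAlgebra.Build F smx smx_scaleAr.

End SupernaturalMatrix.

Section Contains.
Variables (F : fieldType) (A B : algType F).

Definition unital_subalgebra (S : A -> Prop) : Prop :=
  [/\ S 1,
      forall (a : F) u v, S u -> S v -> S (a *: u + v)
    & forall u v, S u -> S v -> S (u * v)].

(* The last two clauses say that [f] is an isomorphism from [B] onto [S]. *)
Definition contains_alg : Prop :=
  exists S : A -> Prop, unital_subalgebra S /\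
    exists f : {lrmorphism B -> A},
      injective f /\ (forall y, S y <-> exists x, f x = y).

End Contains.

(* Main.v *)
From HB Require Import structures.
Require Import Defs.
From mathcomp Require Import all_boot all_order all_algebra.
From mathcomp Require Import perm zify.

Set Implicit Arguments.
Unset Strict Implicit.
Unset Printing Implicit Defensive.

Import GRing.Theory.
Local Open Scope ring_scope.

(* Write N_t = m_1 ... m_t; the algebra M_n(F) is the union of the M_(N_t)(F),
   so what matters is to choose compatible copies of these in A.

   In M_(N_t)(F) the element b_t is a nilpotent Jordan block of size N_t: its
   power m_t splits into m_t blocks of size N_(t-1), i.e. it is diag(b_(t-1),
   ..., b_(t-1)) once the basis is ordered suitably.

   Conversely put f = b_t, N = N_t and p = m_2 ... m_t, so that f^p = b_1,
   f^N = 0 and a f^p + f^(N-p) c = 1.  Some h then satisfies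
   f^(N-1) h = 1 mod A f; after correction by a unit commuting with f it becomes
   a matrix unit e_(0, N-1), and the f^i h f^(N-1-j) are matrix units for which f
   is the Jordan block.  This gives psi_t : M_(N_t)(F) -> A sending the Jordan
   block to b_t, but psi_t need not restrict to psi_(t-1).  Both maps agree on
   the Jordan block of size N_(t-1), hence on its last nonzero power, which is a
   matrix unit, and two homomorphisms from a matrix algebra that agree on one
   matrix unit are conjugate.  Composing the conjugations makes the psi_t
   compatible. *)

(** * Corner elements of a nilpotent *)

Section NilpotentShift.
Variables (R : nzRingType) (f : R).

(** If [f] is the Jordan block of size n + 1 and [h] the matrix unit e_(0, n), the summands are the
    diagonal matrix units. *)
Definition corner_sum (n : nat) (h : R) := \sum_(i < n.+1) f ^+ i * h * f ^+ (n - i).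

(** Multiplying by [f] on either side shifts the summation index, and the two boundary terms contain
    f^(n+1) = 0. *)
Lemma corner_sum_comm n h : f ^+ n.+1 = 0 -> GRing.comm f (corner_sum n h).
Proof.
move=> f0; rewrite /GRing.comm /corner_sum mulr_sumr mulr_suml big_ord_recr big_ord_recl /=.
rewrite subnn subn0 !mulrA -exprS f0 !mul0r addr0.
rewrite expr0 mul1r -mulrA -exprSr f0 mulr0 add0r; apply: eq_bigr => i _.
rewrite !mulrA -exprS -[RHS]mulrA -exprSr; congr (_ * f ^+ _).
by rewrite /bump; have := ltn_ord i; lia.
Qed.

Lemma corner_sum_mod n h : {y | corner_sum n h = f ^+ n * h + y * f}.
Proof.
exists (\sum_(i < n) f ^+ i * h * f ^+ (n - i).-1).
rewrite /corner_sum big_ord_recr /= subnn mulr1 addrC mulr_suml; congr (_ + _).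
apply: eq_bigr => i _; rewrite -[RHS]mulrA -exprSr prednK // subn_gt0; exact: ltn_ord.
Qed.

Lemma corner_sumMr n h v : GRing.comm f v -> corner_sum n (h * v) = corner_sum n h * v.
Proof.
move=> fv; rewrite /corner_sum mulr_suml; apply: eq_bigr => i _.
by rewrite -!mulrA; congr (_ * (_ * _)); apply: commrX; apply: commr_sym.
Qed.

(** As u - 1 = y f commutes with f, (u - 1)^k = y^k f^k. So 1 - u is nilpotent, and v is its
    geometric series. *)
Lemma unipotent_inv n u y : f ^+ n = 0 -> GRing.comm f u -> u = 1 + y * f ->
  {v | GRing.comm f v & u * v = 1}.
Proof.
move=> f0 fu uE; have nuE : u - 1 = y * f by rewrite uE addrC addKr.
have fnu : GRing.comm f (u - 1) by apply: commrB => //; apply: commr1.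
have nuX k : (u - 1) ^+ k = y ^+ k * f ^+ k.
  elim: k => [|k IH]; first by rewrite !expr0 mulr1.
  rewrite exprSr IH -mulrA (commr_sym (commrX k (commr_sym fnu))) {1}nuE.
  by rewrite (exprSr y) (exprS f) !mulrA.
exists (\sum_(i < n) (1 - u) ^+ i).
  by apply: commr_sum => i _; apply: commrX; rewrite -opprB; apply: commrN.
have : (1 - u) ^+ n = 0 by rewrite -opprB exprNn nuX f0 !mulr0.
move/(congr1 (fun x => x - 1)); rewrite /= subrX1 sub0r addrAC subrr sub0r mulNr.
by move/oppr_inj.
Qed.

(* The [e] found here plays the part of the matrix unit e_(0, n), [f] being the
   Jordan block of size n + 1. *)
Lemma corner_unit n h y : f ^+ n.+1 = 0 -> f ^+ n * h = 1 + y * f ->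
  {e | corner_sum n e = 1 &
       forall s, (s <= n)%N -> e * f ^+ s * e = if s == n then e else 0}.
Proof.
move=> f0 hE; have hfE x : f ^+ n * (h * f ^+ n * x) = f ^+ n * x.
  by rewrite !mulrA hE mulrDl mul1r -(mulrA y) -exprS f0 mulr0 addr0.
(* By [hfE], f^n k = f^n h, so [k] keeps the congruence modulo A f; moreover it lies in h f^n A,
   where left multiplication by f^n is injective. *)
pose k := h * f ^+ n * h.
have [z cE] := corner_sum_mod n k; have uE : corner_sum n k = 1 + (y + z) * f.
  by rewrite cE hfE hE mulrDl addrA.
have [v fv uv] := unipotent_inv f0 (corner_sum_comm k f0) uE.
pose e := k * v; have eE : h * f ^+ n * h * v = e by [].
have ce : corner_sum n e = 1 by rewrite corner_sumMr.
clearbody e; exists e => // s sn.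
(* The sum of the right ideals f^i h f^n A is direct, so the expansion of e as
   the sum of the f^i e (f^(n-i) e) must be the trivial one. *)
pose x i := h * v * f ^+ (n - i) * e - (if i == 0%N then h * v else 0).
have dE i : h * f ^+ n * x i = e * f ^+ (n - i) * e - (if i == 0%N then e else 0).
  by rewrite mulrBr (fun_if (fun w => h * f ^+ n * w)) mulr0 !mulrA eE.
have dS : \sum_(i < n.+1) f ^+ i * (h * f ^+ n * x i) = 0.
  under eq_bigr => i _ do rewrite dE mulrBr !mulrA.
  rewrite sumrB -[X in X - _]mulr_suml [X in X * e](ce : _ = 1) mul1r.
  rewrite big_ord_recl /= expr0 mul1r big1 ?addr0 ?subrr // => i _; exact: mulr0.
(* After multiplication by f^(n-j) the terms i > j vanish by nilpotency and the terms i < j by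
   induction, which leaves f^n (x j) = 0. *)
have d0 j : (j <= n)%N -> h * f ^+ n * x j = 0.
  elim/ltn_ind: j => j IH jn.
  have := congr1 (fun w => f ^+ (n - j) * w) dS; rewrite /= mulr0 mulr_sumr.
  have jlt : (j < n.+1)%N by [].
  rewrite (bigD1 (Ordinal jlt)) //= big1 ?addr0 => [|i ij].
    by rewrite mulrA -exprD subnK // hfE -mulrA => ->; rewrite mulr0.
  have [lt|gt|eq] := ltngtP i j; last by case/eqP: ij; apply: val_inj.
    by rewrite IH ?mulr0 // (leq_trans (ltnW lt)).
  rewrite mulrA -exprD (_ : n - j + i = n.+1 + (i - j).-1)%N; last by lia.
  by rewrite exprD f0 !mul0r.
have := d0 (n - s)%N (leq_subr _ _); rewrite dE subKn // => /eqP.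
rewrite subr_eq0 => /eqP ->; rewrite subn_eq0; congr (if _ then _ else _); lia.
Qed.

(** As p > 0, f^q c = 1 - a f^p is 1 modulo A f. The factor f^(q-p+1) in the witness raises the
    leftover f^(p-1) to f^q, so that this identity can be used again. *)
Lemma split_corner p q a c : (0 < p <= q)%N -> f ^+ (p + q) = 0 ->
  a * f ^+ p + f ^+ q * c = 1 ->
  {h & {y | f ^+ (p + q).-1 * h = 1 + y * f}}.
Proof.
case/andP=> p0 pq f0 acE; have qE : f ^+ q * c = 1 - a * f ^+ p.
  by rewrite -acE addrAC subrr add0r.
exists (c * f ^+ (q - p).+1 * c).
exists (- (a * f ^+ p.-1) - f ^+ p.-1 * a * (1 - f * a * f ^+ p.-1)).
rewrite (_ : (p + q).-1 = p.-1 + q)%N; last by lia.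
have sE : f ^+ p.-1 * f ^+ (q - p).+1 = f ^+ q by rewrite -exprD; congr (_ ^+ _); lia.
have spE : f ^+ p * f ^+ (q - p).+1 = f * f ^+ q by rewrite -exprD -exprS; congr (_ ^+ _); lia.
have pE : f ^+ p.-1 * f = f ^+ p by rewrite -exprSr prednK.
rewrite exprD -mulrA 2!(mulrA (f ^+ q)) qE 2!mulrBl mul1r mulrBr mulrA sE qE.
rewrite -(mulrA a) spE -(mulrA a) -(mulrA f) qE mulrBl mulNr -(mulrA a) pE.
rewrite -(mulrA _ _ f) mulrBl mul1r -(mulrA (f * a)) pE mulrBr mulr1.
by rewrite -addrA !mulrA.
Qed.

End NilpotentShift.

(** * Shift matrices and matrix units *)

Section ShiftMatrix.
Variables (F : fieldType) (N : nat) (s : 'S_N).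

(** The k-th power of the Jordan block ([shift_mxX]), for the basis ordered by [s]. *)
Definition shift_mx k : 'M[F]_N := \matrix_(i, j) (s i == s j + k :> nat)%N%:R.

Lemma shift_mx0 : shift_mx 0 = 1.
Proof.
by apply/matrixP=> i j; rewrite !mxE addn0 -(inj_eq (@perm_inj _ s)) -val_eqE.
Qed.

Lemma shift_mxD k l : shift_mx (k + l) = shift_mx k * shift_mx l.
Proof.
apply/matrixP=> i j; rewrite !mxE.
have [lt|le] := ltnP (s j + l) N.
  have sr : s ((s^-1)%g (Ordinal lt)) = Ordinal lt by rewrite permKV.
  rewrite (bigD1 ((s^-1)%g (Ordinal lt))) //= !mxE sr /= eqxx mulr1 big1 ?addr0.
    by rewrite addnA addnAC.
  move=> r /eqP ne; rewrite !mxE; case: (s r =P s j + l :> nat)%N; rewrite ?mulr0 // => e.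
  by case: ne; apply: (@perm_inj _ s); rewrite sr; apply: val_inj.
rewrite big1 => [|r _]; first by case: eqP => // e; have := ltn_ord (s i); lia.
rewrite !mxE; case: (s r =P s j + l :> nat)%N; rewrite ?mulr0 // => e.
by have := ltn_ord (s r); lia.
Qed.

Lemma shift_mxX k : shift_mx k = shift_mx 1 ^+ k.
Proof.
by elim: k => [|k IH]; rewrite ?shift_mx0 ?expr0 // exprSr -IH -shift_mxD addn1.
Qed.

Lemma shift_mx_last (i j : 'I_N) : s i = N.-1 :> nat -> s j = 0%N :> nat ->
  shift_mx N.-1 = delta_mx i j.
Proof.
move=> si sj; apply/matrixP=> i' j'; rewrite !mxE.
rewrite -(inj_eq (@perm_inj _ s) i') -(inj_eq (@perm_inj _ s) j') -!val_eqE /= si sj.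
have := ltn_ord (s i'); have := ltn_ord (s j').
move: (val (s i')) (val (s j')) => x y yN xN; congr (nat_of_bool _)%:R.
by apply/idP/andP; [|case]; lia.
Qed.

End ShiftMatrix.

Section MatrixUnits.
Variables (F : fieldType) (A : algType F).

Section Map.
Variables (N : nat) (E : 'I_N -> 'I_N -> A).

Definition units_map (x : 'M[F]_N) : A := \sum_i \sum_j x i j *: E i j.

Fact units_map_linear : linear units_map.
Proof.
move=> a x y; rewrite /units_map scaler_sumr -big_split; apply: eq_bigr => i _ /=.
rewrite scaler_sumr -big_split; apply: eq_bigr => j _ /=.
by rewrite !mxE scalerDl scalerA.
Qed.

HB.instance Definition _ :=
  GRing.isLinear.Build F 'M[F]_N A *:%R units_map units_map_linear.

Lemma units_map_monoid :
  \sum_i E i i = 1 ->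
  (forall i j k l, E i j * E k l = if j == k then E i l else 0) ->
  monoid_morphism units_map.
Proof.
move=> E1 EM; split.
  rewrite -E1; apply: eq_bigr => i _; rewrite (bigD1 i) //= big1 ?addr0.
    by rewrite !mxE eqxx scale1r.
  by move=> j /negbTE ne; rewrite !mxE eq_sym ne scale0r.
move=> x y; rewrite /units_map mulr_suml; apply: eq_bigr => i _.
rewrite mulr_suml.
transitivity (\sum_l \sum_j (x i j * y j l) *: E i l).
  by apply: eq_bigr => l _; rewrite mxE scaler_suml.
rewrite exchange_big; apply: eq_bigr => j _ /=.
rewrite mulr_sumr [RHS](bigD1 j) //= [X in _ = _ + X]big1 ?addr0.
  rewrite mulr_sumr; apply: eq_bigr => l _.
  by rewrite -scalerAl -scalerAr EM eqxx scalerA.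
move=> k /negbTE ne; rewrite mulr_sumr big1 // => l _.
by rewrite -scalerAl -scalerAr EM eq_sym ne !scaler0.
Qed.

End Map.

Lemma shift_units N (s : 'S_N) (f h y : A) :
  (0 < N)%N -> f ^+ N = 0 -> f ^+ N.-1 * h = 1 + y * f ->
  {phi : {linear 'M[F]_N -> A} | monoid_morphism phi & phi (shift_mx F s 1) = f}.
Proof.
case: N s => // n s _ f0 /(corner_unit f0)[e e1 eM].
pose E (i j : 'I_n.+1) := f ^+ s i * e * f ^+ (n - s j).
have E1 : \sum_i E i i = 1.
  by rewrite -e1 /corner_sum [RHS](reindex_inj (@perm_inj _ s)).
have EM i j k l : E i j * E k l = if j == k then E i l else 0.
  have -> : E i j * E k l = f ^+ s i * (e * f ^+ (n - s j + s k) * e) * f ^+ (n - s l).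
    by rewrite exprD !mulrA.
  have [jn kn] := (ltn_ord (s j), ltn_ord (s k)).
  rewrite -(inj_eq (@perm_inj _ s)) -val_eqE /=.
  have [lt|gt|eq] := ltngtP (s j : nat) (s k).
  (* Between the two factors [e] the exponent of f is n - s j + s k: above n the product is 0 by
     nilpotency, below n it is 0 by [eM], and at n it is [e]. *)
  - have -> : (n - s j + s k = n.+1 + (s k - s j).-1)%N by lia.
    by rewrite exprD f0 !(mul0r, mulr0).
  - rewrite eM; last by lia.
    by case: eqP => [|_]; [lia|rewrite mulr0 mul0r].
  - by rewrite eM; [case: eqP => //|]; lia.
exists (units_map E); first exact: units_map_monoid.
(* Expand f as the sum over j of f E_(j,j). This term is E_(r,j) with s r = s j + 1, or 0 for the
   last j, where f^(n+1) appears. *)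
rewrite /= /units_map exchange_big /= -[RHS]mulr1 -E1 mulr_sumr.
apply: eq_bigr => j _; rewrite /E !mulrA -exprS.
have [lt|ge] := ltnP (s j).+1 n.+1.
  have sr : s ((s^-1)%g (Ordinal lt)) = Ordinal lt by rewrite permKV.
  rewrite (bigD1 ((s^-1)%g (Ordinal lt))) //= !mxE sr /= addn1 eqxx scale1r big1 ?addr0 //.
  move=> r /eqP ne; rewrite !mxE; case: eqP; rewrite ?scale0r // => er.
  by case: ne; apply: (@perm_inj _ s); rewrite sr; apply: val_inj; rewrite /= er addn1.
rewrite (_ : (s j).+1 = n.+1) ?f0 ?mul0r; last by have := ltn_ord (s j); lia.
rewrite big1 // => i _; rewrite !mxE; case: eqP; rewrite ?scale0r // => er.
by have := ltn_ord (s i); lia.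
Qed.

Lemma monoid_morphX N (phi : {linear 'M[F]_N -> A}) x k :
  monoid_morphism phi -> phi (x ^+ k) = phi x ^+ k.
Proof. by case=> p1 pM; elim: k => [|k IH] //; rewrite !exprS pM IH. Qed.

Lemma monoid_delta N (phi : {linear 'M[F]_N -> A}) i j k l :
  monoid_morphism phi ->
  phi (delta_mx i j) * phi (delta_mx k l) = if j == k then phi (delta_mx i l) else 0.
Proof.
case=> _ phiM; rewrite -phiM -[_ * _]/(_ *m _) mul_delta_mx_cond.
by case: eqP; rewrite ?mulr1n // mulr0n raddf0.
Qed.

Lemma monoid_sum_delta N (phi : {linear 'M[F]_N -> A}) :
  monoid_morphism phi -> \sum_i phi (delta_mx i i) = 1.
Proof.
case=> phi1 _; rewrite -phi1 -raddf_sum; congr (phi _).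
apply/matrixP=> i j; rewrite summxE !mxE (bigD1 i) //= big1 ?addr0.
  by rewrite mxE eqxx eq_sym.
by move=> k /negbTE ki; rewrite mxE eq_sym ki.
Qed.

Lemma mul_delta_mx_delta N (x : 'M[F]_N) i j (k : 'I_N) :
  delta_mx k i *m x *m delta_mx j k = x i j *: delta_mx k k.
Proof.
apply/matrixP=> a b; rewrite !mxE (bigD1 j) //= big1 ?addr0 => [|c /negbTE cj].
  rewrite !mxE (bigD1 i) //= big1 ?addr0 => [|c /negbTE ci].
    by rewrite !mxE !eqxx andbT /= mulrAC -natrM mulnb mulrC.
  by rewrite mxE ci andbF mul0r.
by rewrite [X in _ * X]mxE cj mulr0.
Qed.

(** Simplicity of M_N(F): if x_(i,j) is nonzero, sandwiching x between matrix units shows that [phi]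
    kills every e_(k,k), hence 1, but A is nonzero. *)
Lemma matrix_hom_eq0 N (phi : {linear 'M[F]_N -> A}) x :
  monoid_morphism phi -> phi x = 0 -> x = 0.
Proof.
move=> hphi phix; apply/matrixP=> i j; rewrite mxE; apply/eqP; apply: contraT => xij.
suff /eqP : (1 : A) = 0 by rewrite oner_eq0.
rewrite -(monoid_sum_delta hphi) big1 // => k _.
have : x i j *: phi (delta_mx k k) = 0.
  rewrite -linearZ -mul_delta_mx_delta.
  by rewrite -![_ *m _]/(_ * _) !hphi.2 phix mulr0 mul0r.
by move/(congr1 (GRing.scale (x i j)^-1)); rewrite scalerA mulVf // scale1r scaler0.
Qed.

Section Conjugation.
Variables (N : nat) (l z : 'I_N).
Implicit Types phi psi : {linear 'M[F]_N -> A}.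

Definition intertwiner phi psi := \sum_i phi (delta_mx i z) * psi (delta_mx z i).

(** Writing e_(i,z) = e_(i,l) e_(l,z) and replacing phi(e_(l,z)) by psi(e_(l,z)) absorbs the middle
    factor psi(e_(z,z)), so the i-th term of the product is phi(e_(i,i)). *)
Lemma intertwinerK phi psi : monoid_morphism phi -> monoid_morphism psi ->
  phi (delta_mx l z) = psi (delta_mx l z) ->
  intertwiner phi psi * intertwiner psi phi = 1.
Proof.
move=> hphi hpsi agree; rewrite -(monoid_sum_delta hphi) mulr_suml.
apply: eq_bigr => i _; rewrite mulr_sumr (bigD1 i) //= big1 ?addr0.
  rewrite !mulrA -(mulrA (phi _)) monoid_delta // eqxx.
  have -> : phi (delta_mx i z) = phi (delta_mx i l) * psi (delta_mx l z).
    by rewrite -agree monoid_delta // eqxx.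
  by rewrite -(mulrA (phi _)) monoid_delta // eqxx -agree !(monoid_delta, eqxx).
move=> k /negbTE ki; rewrite !mulrA -(mulrA (phi _)) monoid_delta // eq_sym ki.
by rewrite mulr0 mul0r.
Qed.

(** At x = e_(i,j) both sides reduce to phi(e_(i,z)) psi(e_(z,j)). *)
Lemma intertwinerP phi psi x : monoid_morphism phi -> monoid_morphism psi ->
  phi x * intertwiner phi psi = intertwiner phi psi * psi x.
Proof.
move=> hphi hpsi; rewrite (matrix_sum_delta x) !raddf_sum /= mulr_suml mulr_sumr.
apply: eq_bigr => i _; rewrite !raddf_sum /= mulr_suml mulr_sumr; apply: eq_bigr => j _.
rewrite !linearZ /= -scalerAl -scalerAr mulr_suml mulr_sumr; congr (_ *: _).
rewrite (bigD1 j) //= [RHS](bigD1 i) //= !big1 ?addr0.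
- by rewrite mulrA -[RHS]mulrA !monoid_delta // !eqxx.
- by move=> k /negbTE ki; rewrite -mulrA monoid_delta // ki mulr0.
by move=> k /negbTE kj; rewrite mulrA monoid_delta // eq_sym kj mul0r.
Qed.

End Conjugation.

End MatrixUnits.

(** For the Jordan block J, J^T J is the identity without the diagonal unit at the last place in the
    order [s], and J^(N-1) (J^(N-1))^T is that unit. At N = m_1 this is the relation required of a,
    b_1 and c. *)
Lemma shift_mx_split (F : fieldType) N (s : 'S_N) : (0 < N)%N ->
  (shift_mx F s 1)^T * shift_mx F s 1 + shift_mx F s N.-1 * (shift_mx F s N.-1)^T = 1.
Proof.
move=> N0; have lN : (N.-1 < N)%N by rewrite prednK.
pose l := (s^-1)%g (Ordinal lN); pose z := (s^-1)%g (Ordinal N0).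
have sl : s l = N.-1 :> nat by rewrite permKV.
rewrite (@shift_mx_last _ _ _ l z) ?permKV // trmx_delta -[_ * delta_mx _ _]/(_ *m _).
rewrite mul_delta_mx; apply/matrixP=> i j; rewrite !mxE.
transitivity (((i == j) && (s i != N.-1 :> nat))%:R + ((i == l) && (j == l))%:R : F).
  congr (_ + _); have [lt|ge] := ltnP (s i).+1 N.
    have sr : s ((s^-1)%g (Ordinal lt)) = Ordinal lt by rewrite permKV.
    rewrite (bigD1 ((s^-1)%g (Ordinal lt))) //= !mxE sr /= addn1 eqxx mul1r big1 ?addr0.
      rewrite addn1 eqSS -(inj_eq (@perm_inj _ s)) -val_eqE /=; congr (nat_of_bool _)%:R.
      by case: eqP => //=; lia.
    move=> r /eqP ne; rewrite !mxE; case: (s r =P s i + 1 :> nat)%N; rewrite ?mul0r // => e.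
    by case: ne; apply: (@perm_inj _ s); rewrite sr; apply: val_inj; rewrite /= e addn1.
  rewrite (_ : _ && _ = false); last by have := ltn_ord (s i); case: eqP => //=; lia.
  rewrite big1 // => r _; rewrite !mxE; case: (s r =P s i + 1 :> nat)%N; rewrite ?mul0r // => e.
  by have := ltn_ord (s r); lia.
rewrite -natrD -sl val_eqE (inj_eq (@perm_inj _ s)); congr _%:R.
have [<-|ne] := eqVneq i j; first by rewrite andbb; case: eqP.
by have [il|//] := eqVneq i l; rewrite -il eq_sym (negbTE ne).
Qed.

(** * Digit reversal and compatible Jordan blocks *)

Section DigitReversal.
Variables (F : fieldType) (m : nat -> nat).
Hypothesis m_gt0 : forall t, (1 <= t)%N -> (0 < m t)%N.

Definition radix t := (\prod_(1 <= i < t.+1) m i)%N.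

Lemma radix0 : radix 0 = 1%N.
Proof. by rewrite /radix big_geq. Qed.

Lemma radixS t : radix t.+1 = (radix t * m t.+1)%N.
Proof. by rewrite /radix big_nat_recr. Qed.

Lemma radix1 : radix 1 = m 1.
Proof. by rewrite radixS radix0 mul1n. Qed.

Lemma radix_gt0 t : (0 < radix t)%N.
Proof. by elim: t => [|t IH]; rewrite ?radix0 // radixS muln_gt0 IH m_gt0. Qed.

Lemma dvdn_radix t u : (t <= u)%N -> (radix t %| radix u)%N.
Proof.
move/subnK<-; elim: (u - t)%N => // k IH.
by rewrite addSn radixS dvdn_mulr.
Qed.

Lemma logn_radix p t : logn p (radix t) = (\sum_(1 <= i < t.+1) logn p (m i))%N.
Proof.
elim: t => [|t IH]; first by rewrite radix0 logn1 big_geq.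
by rewrite radixS lognM ?radix_gt0 ?m_gt0 // IH [RHS]big_nat_recr.
Qed.

(* In the order given by [digit_rev t.+1] the copies of M_(radix t) on the
   diagonal are interleaved, so that the shift by [m t.+1] acts on each of them
   as the shift by 1. *)
Fixpoint digit_rev t i :=
  if t is t'.+1 then (i %/ radix t' + m t * digit_rev t' (i %% radix t'))%N else 0%N.

Lemma digit_rev_lt t i : (i < radix t)%N -> (digit_rev t i < radix t)%N.
Proof.
elim: t i => [|t IH] i; first by rewrite radix0.
rewrite radixS /= => lt.
have q_lt : (i %/ radix t < m t.+1)%N by rewrite ltn_divLR ?radix_gt0 // mulnC.
have := IH _ (ltn_pmod i (radix_gt0 t)); nia.
Qed.

Lemma digit_rev_inj t i j : (i < radix t)%N -> (j < radix t)%N ->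
  digit_rev t i = digit_rev t j -> i = j.
Proof.
elim: t i j => [|t IH] i j; first by rewrite radix0; case: i => //; case: j.
rewrite radixS mulnC /= => lti ltj e.
have [qi qj] : (i %/ radix t < m t.+1 /\ j %/ radix t < m t.+1)%N.
  by rewrite !ltn_divLR ?radix_gt0.
have m0 : (0 < m t.+1)%N by apply: m_gt0.
have qE : (i %/ radix t = j %/ radix t)%N.
  by have := congr1 (modn^~ (m t.+1)) e; rewrite /= ![(_ + m _ * _)%N]addnC
    ![(m _ * _)%N]mulnC !modnMDl !modn_small.
move: e; rewrite qE => /addnI/eqP; rewrite eqn_pmul2l // => /eqP/IH rE.
by rewrite (divn_eq i (radix t)) qE rE ?ltn_pmod ?radix_gt0 // -divn_eq.
Qed.

Definition digit_ord t (i : 'I_(radix t)) : 'I_(radix t) := Ordinal (digit_rev_lt (ltn_ord i)).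

Fact digit_ord_inj t : injective (@digit_ord t).
Proof. by move=> i j [] /digit_rev_inj e; apply/val_inj/e. Qed.

Definition digit_perm t : 'S_(radix t) := perm (@digit_ord_inj t).

Definition jordan t := shift_mx F (digit_perm t) 1.

Lemma jordan0 : jordan 0 = 0.
Proof.
apply/matrixP=> i j; rewrite !mxE; case: eqP => // e.
by have := ltn_ord (digit_perm 0 i); rewrite [X in (_ < X)%N]radix0 e addn1.
Qed.

(** With s the digit reversal, reducing s i = s j + m_(t+1) modulo m_(t+1) puts i and j in the same
    diagonal block; dividing by m_(t+1) then gives the condition for [jordan t]. *)
Lemma jordanX t : jordan t.+1 ^+ m t.+1 = diag_rep (radix_gt0 t) (radix t.+1) (jordan t).
Proof.
rewrite -shift_mxX; apply/matrixP=> i j; rewrite !mxE !permE /=.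
have m0 : (0 < m t.+1)%N by apply: m_gt0.
have q_lt (k : 'I_(radix t.+1)) : (k %/ radix t < m t.+1)%N.
  by rewrite ltn_divLR ?radix_gt0 // mulnC -radixS.
have [qi qj] := (q_lt i, q_lt j).
case: ifP => [/eqP ->|/eqP ne].
  by rewrite -addnA eqn_add2l -mulnSr eqn_pmul2l // addn1.
case: eqP => // e; case: ne.
move: e; rewrite -addnA -mulnSr => /(congr1 (modn^~ (m t.+1))) /=.
by rewrite ![(_ + m _ * _)%N]addnC ![(m _ * _)%N]mulnC !modnMDl !modn_small.
Qed.

End DigitReversal.

(** * Maps of the direct system as homomorphisms, and cofinality of the partial products *)

Fact diag_rep_linear (F : fieldType) d (d0 : (0 < d)%N) k :
  linear (@diag_rep F d d0 k).
Proof. by move=> a x y; rewrite diag_repD diag_repZ. Qed.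

HB.instance Definition _ (F : fieldType) d (d0 : (0 < d)%N) k :=
  GRing.isLinear.Build F 'M[F]_d 'M[F]_k *:%R (@diag_rep F d d0 k)
    (@diag_rep_linear F d d0 k).

Lemma diag_rep_monoid (F : fieldType) d (d0 : (0 < d)%N) k : (d %| k)%N ->
  monoid_morphism (@diag_rep F d d0 k).
Proof. by move=> dk; split; [apply: diag_rep1 | apply: diag_repM]. Qed.

Section Supernatural.
Variables (F : fieldType) (n : supernatural).

Lemma smx_in_monoid (d : divisor n) : monoid_morphism (@smx_in F n d).
Proof. by split; [apply: smx_in1 | apply: smx_inM]. Qed.

Fact smx_in_linear (d : divisor n) : linear (@smx_in F n d).
Proof. by move=> a x y; rewrite smx_inD smx_inZ. Qed.

HB.instance Definition _ (d : divisor n) :=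
  GRing.isLinear.Build F 'M[F]_d (smx F n) *:%R (@smx_in F n d) (@smx_in_linear d).

Lemma smx_inX (d : divisor n) (x : 'M[F]_d) k : smx_in (x ^+ k) = smx_in x ^+ k.
Proof.
by elim: k => [|k IH]; rewrite ?exprS ?(smx_in_monoid d).1 // (smx_in_monoid d).2 IH.
Qed.

Variable m : nat -> nat.
Hypothesis m_gt0 : forall t, (1 <= t)%N -> (0 < m t)%N.
Hypothesis n_prod : is_sn_prod n m.

Lemma leq_sum_logn p t u : (t <= u)%N ->
  (\sum_(1 <= i < t) logn p (m i) <= \sum_(1 <= i < u) logn p (m i))%N.
Proof.
have [->|t0 tu] := posnP t; first by rewrite big_geq.
by rewrite [leqRHS](big_cat_nat t0 tu) leq_addr.
Qed.

Lemma dvd_sn_radix t : dvd_sn (radix m t) n.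
Proof.
apply/dvd_snP; split=> [|p pp]; first exact: radix_gt0.
have := n_prod pp; case: (n p) => //= k [T kE].
rewrite logn_radix // -(kE (maxn T t.+1)) ?leq_maxl //.
exact/leq_sum_logn/leq_maxr.
Qed.

Definition radix_div t : divisor n := Divisor (dvd_sn_radix t).

(** Each of the finitely many primes of [d] reaches its exponent after finitely many factors. [sigW]
    yields an actual stage, from which [smx_lim] is defined. *)
Lemma dvd_sn_dvd_radix d : dvd_sn d n -> {t | (d %| radix m t)%N}.
Proof.
move=> /dvd_snP[d0 dn]; apply: sigW.
have [t le] : exists t, forall p, p \in primes d -> (logn p d <= logn p (radix m t))%N.
  have : forall p, p \in primes d -> prime p by move=> p; rewrite mem_primes => /andP[].
  elim: (primes d) => [|p s IH] sp; first by exists 0%N.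
  have [|t ht] := IH; first by move=> q qs; apply: sp; rewrite inE qs orbT.
  have pp : prime p by apply: sp; rewrite inE eqxx.
  have [u hu] : exists u, (logn p d <= logn p (radix m u))%N.
    have := dn p pp; have := n_prod pp; case: (n p) => [k [T kE] le|H _].
      by exists T; rewrite (leq_trans le) // logn_radix // (kE T.+1).
    have [T le] := H (logn p d); exists T; rewrite logn_radix // (leq_trans le) //.
    exact: leq_sum_logn.
  exists (maxn t u) => q; rewrite inE => /predU1P[->|/ht].
    by move/leq_trans: hu; apply; rewrite dvdn_leq_log ?radix_gt0 // dvdn_radix // leq_maxr.
  by move/leq_trans; apply; rewrite dvdn_leq_log ?radix_gt0 // dvdn_radix // leq_maxl.
exists t; apply/dvdn_partP => // p pd; rewrite p_part pfactor_dvdn ?radix_gt0 ?le //.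
by move: pd; rewrite mem_primes => /andP[].
Qed.

End Supernatural.

(** * Homomorphisms from the direct limit *)

Section Simple.
Variables (F : fieldType) (n : supernatural) (A : algType F).

(** Every element comes from some M_d(F), on which a homomorphism to A is injective. *)
Lemma smx_hom_inj (f : {lrmorphism smx F n -> A}) : injective f.
Proof.
apply: raddf_inj => u; have [d [x ->]] := smx_in_surj u => fx0.
have h : monoid_morphism (f \o @smx_in F n d).
  by split=> [|y z] /=; rewrite ?(smx_in_monoid F d).1 ?rmorph1 // (smx_in_monoid F d).2 rmorphM.
by rewrite (matrix_hom_eq0 h fx0) raddf0.
Qed.

Lemma contains_alg_of_hom (f : {lrmorphism smx F n -> A}) : contains_alg A (smx F n).
Proof.
exists (fun y => exists x, f x = y); split; last first.
  by exists f; split; [apply: smx_hom_inj|].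
split; first by exists 1; rewrite rmorph1.
- by move=> a _ _ [x <-] [y <-]; exists (a *: x + y); rewrite linearP.
- by move=> _ _ [x <-] [y <-]; exists (x * y); rewrite rmorphM.
Qed.

End Simple.

Section Limit.
Variables (F : fieldType) (n : supernatural) (m : nat -> nat).
Hypothesis m_gt0 : forall t, (1 <= t)%N -> (0 < m t)%N.
Hypothesis n_prod : is_sn_prod n m.
Variables (A : algType F) (phi : forall t, {linear 'M[F]_(radix m t) -> A}).
Hypothesis phi_monoid : forall t, monoid_morphism (phi t).
Hypothesis phi_diag : forall t x,
  phi t.+1 (diag_rep (radix_gt0 m_gt0 t) (radix m t.+1) x) = phi t x.

(** Computed from a chosen representative at a chosen stage; [smx_limE] shows that neither choice
    matters. *)
Definition smx_lim (u : smx F n) : A :=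
  let: existT d x := generic_quotient.repr u in
  phi (sval (dvd_sn_dvd_radix m_gt0 n_prod (div_valP d))) (diag_rep (div_gt0 d) _ x).

Lemma phi_diag_rep d (d0 : (0 < d)%N) t u (x : 'M[F]_d) :
  (d %| radix m t)%N -> (t <= u)%N ->
  phi u (diag_rep d0 (radix m u) x) = phi t (diag_rep d0 (radix m t) x).
Proof.
move=> dt /subnK<-; elim: (u - t)%N => // k <-.
have dk : (d %| radix m (k + t))%N by apply/(dvdn_trans dt)/dvdn_radix/leq_addl.
by rewrite -[RHS]phi_diag diag_rep_comp.
Qed.

Lemma smx_limE (d : divisor n) (x : 'M[F]_d) t : (d %| radix m t)%N ->
  smx_lim (smx_in x) = phi t (diag_rep (div_gt0 d) (radix m t) x).
Proof.
move=> dt; rewrite /smx_lim; have := smx_reprE (smx_in x).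
case: (generic_quotient.repr _) => e y /= eyx; case: (dvd_sn_dvd_radix _ _ _) => u eu /=.
rewrite -(phi_diag_rep (div_gt0 e) y eu (leq_maxl u t)).
rewrite -(phi_diag_rep (div_gt0 d) x dt (leq_maxr u t)); congr (phi _ _).
have [dk ek] : (d %| radix m (maxn u t) /\ e %| radix m (maxn u t))%N.
  by split; [apply: dvdn_trans dt _ | apply: dvdn_trans eu _];
    rewrite dvdn_radix ?leq_maxl ?leq_maxr.
exact/(smx_inE (k := radix_div m_gt0 n_prod (maxn u t)) y x ek dk).
Qed.

Lemma smx_lim_linear : linear smx_lim.
Proof.
move=> a u v; have [d [x [y [-> ->]]]] := smx_in_surj2 u v.
have [t dt] := dvd_sn_dvd_radix m_gt0 n_prod (div_valP d).
rewrite -[a *: _]/(smx_scale _ _) -smx_inZ -[_ + _]/(smx_add _ _) -smx_inD.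
by rewrite !(smx_limE _ dt) !linearP.
Qed.

Lemma smx_lim_monoid : monoid_morphism smx_lim.
Proof.
split.
  rewrite -[1]/(smx_one F n) (@smx_limE _ _ 0%N) ?dvd1n //.
  by rewrite diag_rep1 (phi_monoid 0).1.
move=> u v; have [d [x [y [-> ->]]]] := smx_in_surj2 u v.
have [t dt] := dvd_sn_dvd_radix m_gt0 n_prod (div_valP d).
rewrite -[_ * _]/(smx_mul _ _) -smx_inM.
by rewrite !(smx_limE _ dt) diag_repM // -(phi_monoid t).2.
Qed.

HB.instance Definition _ := GRing.isLinear.Build F (smx F n) A *:%R smx_lim smx_lim_linear.
HB.instance Definition _ := GRing.isMonoidMorphism.Build (smx F n) A smx_lim smx_lim_monoid.

Lemma contains_alg_smx_lim : contains_alg A (smx F n).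
Proof. exact: contains_alg_of_hom smx_lim. Qed.

End Limit.

(** * Compatible homomorphisms from a chain of roots *)

Section Conjugate.
Variables (F : fieldType) (N : nat) (A : algType F) (u v : A).
Variable phi : {linear 'M[F]_N -> A}.

Definition conj_map (x : 'M[F]_N) := u * phi x * v.

Fact conj_map_linear : linear conj_map.
Proof.
by move=> a x y; rewrite /conj_map linearP mulrDr mulrDl -scalerAr -scalerAl.
Qed.

HB.instance Definition _ :=
  GRing.isLinear.Build F 'M[F]_N A *:%R conj_map conj_map_linear.

Lemma conj_map_monoid : u * v = 1 -> v * u = 1 ->
  monoid_morphism phi -> monoid_morphism conj_map.
Proof.
move=> uv vu [phi1 phiM]; split; first by rewrite /conj_map phi1 mulr1.
move=> x y; rewrite /conj_map phiM !mulrA; congr (_ * _ * _).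
by rewrite -[RHS]mulrA vu mulr1.
Qed.

End Conjugate.

Section Chain.
Variables (F : fieldType) (m : nat -> nat).
Hypothesis m_gt0 : forall t, (1 <= t)%N -> (0 < m t)%N.
Hypothesis m1_gt1 : (1 < m 1)%N.
Variables (A : algType F) (a c : A) (b : nat -> A).
Hypothesis b0 : b 0 = 0.
Hypothesis bX : forall t, (1 <= t)%N -> b t ^+ m t = b t.-1.
Hypothesis b1_split : a * b 1 + b 1 ^+ (m 1 - 1) * c = 1.

Lemma chain_nilpotent t : b t ^+ radix m t = 0.
Proof.
elim: t => [|t IH]; first by rewrite radix0 b0.
by rewrite radixS mulnC exprM bX.
Qed.

Lemma chain_root t : b t.+1 ^+ (\prod_(2 <= i < t.+2) m i) = b 1.
Proof.
elim: t => [|t IH]; first by rewrite big_geq.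
by rewrite big_nat_recr //= mulnC exprM bX.
Qed.

Lemma chain_corner t : {h & {y | b t ^+ (radix m t).-1 * h = 1 + y * b t}}.
Proof.
(* For t = 0 the exponent N_0 - 1 is 0, and b_0^0 = 1. *)
case: t => [|t]; first by exists 1, 0; rewrite radix0 mul0r addr0 mulr1.
have := chain_root t; set p := (\prod_(2 <= i < _) _)%N => bp.
have p0 : (0 < p)%N.
  by rewrite /p big_nat_cond prodn_cond_gt0 // => i /andP[/andP[i2 _] _]; rewrite m_gt0 // ltnW.
have pqE : (p + p * (m 1 - 1) = radix m t.+1)%N.
  by rewrite -mulnS subn1 prednK 1?ltnW // /radix big_ltn // mulnC.
(* Here q = p (m_1 - 1), so p <= q amounts to m_1 > 1, and b_t^p = b_1 turns the given relation into
   the one needed. *)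
rewrite -pqE; apply: (@split_corner _ (b t.+1) p _ a c).
- by rewrite p0 leq_pmulr // subn_gt0.
- by rewrite pqE chain_nilpotent.
- by rewrite exprM bp.
Qed.

Lemma chain_hom t : {phi : {linear 'M[F]_(radix m t) -> A} |
  monoid_morphism phi & phi (jordan F m_gt0 t) = b t}.
Proof.
have [h [y hE]] := chain_corner t.
exact: shift_units (radix_gt0 m_gt0 t) (chain_nilpotent t) hE.
Qed.

Definition chain_phi t := s2val (chain_hom t).

Definition chain_phi' t : {linear 'M[F]_(radix m t) -> A} :=
  chain_phi t.+1 \o diag_rep (radix_gt0 m_gt0 t) (radix m t.+1).

Lemma chain_phi_monoid t : monoid_morphism (chain_phi t).
Proof. exact: s2valP (chain_hom t). Qed.

Lemma chain_phi'_monoid t : monoid_morphism (chain_phi' t).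
Proof.
have [d1 dM] := diag_rep_monoid F (radix_gt0 m_gt0 t) (dvdn_radix m (leqnSn t)).
have [p1 pM] := chain_phi_monoid t.+1.
by split=> [|x y] /=; rewrite ?d1 ?dM // pM.
Qed.

Definition first_ord t := ((digit_perm m_gt0 t)^-1)%g (Ordinal (radix_gt0 m_gt0 t)).

Lemma last_radix_lt t : ((radix m t).-1 < radix m t)%N.
Proof. by rewrite prednK ?radix_gt0. Qed.

Definition last_ord t := ((digit_perm m_gt0 t)^-1)%g (Ordinal (last_radix_lt t)).

Lemma chain_agree t (e := delta_mx (last_ord t) (first_ord t)) :
  chain_phi t e = chain_phi' t e.
Proof.
have -> : e = jordan F m_gt0 t ^+ (radix m t).-1.
  by rewrite -shift_mxX; apply/esym/shift_mx_last; rewrite permKV.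
rewrite (monoid_morphX _ _ (chain_phi_monoid t)) (monoid_morphX _ _ (chain_phi'_monoid t)).
(* [jordan t] embeds as a power of [jordan t.+1], whose image is b_(t+1)^(m_(t+1)) = b_t. *)
rewrite /chain_phi' /= -jordanX (monoid_morphX _ _ (chain_phi_monoid t.+1)).
by rewrite /chain_phi !(s2valP' (chain_hom _)) bX.
Qed.

Definition chain_conj t := intertwiner (first_ord t) (chain_phi t) (chain_phi' t).
Definition chain_conjV t := intertwiner (first_ord t) (chain_phi' t) (chain_phi t).

Lemma chain_conjK t : chain_conj t * chain_conjV t = 1 /\ chain_conjV t * chain_conj t = 1.
Proof.
by split; apply: (@intertwinerK _ _ _ (last_ord t));
  rewrite ?chain_agree //; by [apply: chain_phi_monoid | apply: chain_phi'_monoid].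
Qed.

(** The product of the first t conjugating units, paired with its inverse. *)
Fixpoint chain_unit t : A * A :=
  if t is t'.+1 then (fst (chain_unit t') * chain_conj t', chain_conjV t' * snd (chain_unit t'))
  else (1, 1).

Lemma chain_unitK t : (chain_unit t).1 * (chain_unit t).2 = 1 /\
                      (chain_unit t).2 * (chain_unit t).1 = 1.
Proof.
elim: t => [|t [uv vu]] /=; first by rewrite mulr1.
have [ij ji] := chain_conjK t.
split; first by rewrite mulrA -(mulrA _ (chain_conj t)) ij mulr1.
by rewrite mulrA -(mulrA (chain_conjV t)) vu mulr1.
Qed.

Definition chain_lim t : {linear 'M[F]_(radix m t) -> A} :=
  conj_map (chain_unit t).1 (chain_unit t).2 (chain_phi t).

Lemma chain_lim_monoid t : monoid_morphism (chain_lim t).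
Proof.
have [uv vu] := chain_unitK t; exact: conj_map_monoid uv vu (chain_phi_monoid t).
Qed.

(** The newest factor of [chain_unit t.+1] conjugates [chain_phi' t] into [chain_phi t]; the older
    factors are common to both sides. *)
Lemma chain_lim_diag t x :
  chain_lim t.+1 (diag_rep (radix_gt0 m_gt0 t) (radix m t.+1) x) = chain_lim t x.
Proof.
rewrite /chain_lim /= /conj_map /=.
have -> : chain_phi t.+1 (diag_rep (radix_gt0 m_gt0 t) (radix m t.+1) x) = chain_phi' t x.
  by [].
rewrite !mulrA; congr (_ * _).
rewrite -(mulrA _ (chain_conj t)) /chain_conj.
rewrite -(intertwinerP _ _ (chain_phi_monoid t) (chain_phi'_monoid t)) -/(chain_conj t).
by rewrite -!mulrA (chain_conjK t).1 mulr1.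
Qed.

End Chain.

(** * The equivalence: gluing the compatible maps, and transporting the Jordan blocks *)

Theorem theorem1p4 (F : fieldType) (n : supernatural) (m : nat -> nat)
    (m_gt0 : forall t, (1 <= t)%N -> (0 < m t)%N)
    (m1_gt1 : (1 < m 1%N)%N)
    (n_prod : is_sn_prod n m)
    (A : algType F) :
  contains_alg A (smx F n) <->
  exists (a c : A) (b : nat -> A),
    [/\ b 0%N = 0,
        forall t, (1 <= t)%N -> b t ^+ m t = b t.-1
      & a * b 1%N + b 1%N ^+ (m 1%N - 1)%N * c = 1].
Proof.
split=> [[_ [_ [f _]]]|[a [c [b [b0 bX b1]]]]]; last first.
  exact (contains_alg_smx_lim n_prod (chain_lim_monoid m_gt0 m1_gt1 b0 bX b1)
           (chain_lim_diag m_gt0 m1_gt1 b0 bX b1)).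
pose d := radix_div m_gt0 n_prod.
pose J t : 'M[F]_(d t) := jordan F m_gt0 t.
(* The b_t are the images of the Jordan blocks, and a, c those of the transposes in [shift_mx_split]
   for N = m_1. *)
exists (f (smx_in (J 1)^T)), (f (smx_in ((J 1) ^+ (m 1 - 1))^T)), (fun t => f (smx_in (J t))).
split.
- by rewrite /J jordan0 raddf0 raddf0.
- case=> // t _; rewrite -rmorphXn -smx_inX; congr (f _).
  rewrite /J jordanX (bool_irrelevance (radix_gt0 _ _) (div_gt0 (d t))).
  exact: (@smx_in_compat F n (d t) (d t.+1) _ (dvdn_radix m (leqnSn t))).
rewrite -rmorphXn -smx_inX -!rmorphM -rmorphD.
rewrite -!(smx_in_monoid F (d 1)).2 -raddfD -(rmorph1 f); congr (f _).
rewrite -(smx_in_monoid F (d 1)).1; congr smx_in.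
rewrite -shift_mxX (_ : m 1 - 1 = (radix m 1).-1)%N; last by rewrite radix1 subn1.
exact: shift_mx_split (radix_gt0 m_gt0 1).
Qed.
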